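(* Let $G=(V,E)$ be an undirected graph with $n=|V|$, $\epsilon\in(0,1]$, $\delta\in(0,1/e]$, $\epsilon'=\frac{(1-e^{-1})\epsilon}{8\ln(e/\delta)}$, and let $c\ge\frac1{\epsilon'}+1$ be the algorithm's fixed offset constant. Algorithm ParDenseDP: set $S_1=V$, $t=1$; while $S_t\ne\emptyset$, independently select each $j\in S_t$ with probability $\exp(-\epsilon'(\deg_{S_t}(j)+c))$, let $S_{t+1}$ be $S_t$ minus the selected nodes, and increment $t$; finally, among the distinct nonempty sets of the sequence $S_1,S_2,\ldots$, output a set $S$ chosen with probability proportional to $\exp(\epsilon\rho(S)/2)$. Let $S^*\subseteq V$ maximize $\rho$. Then with probability at least $1-2/n$, the output $S$ satisfies $\rho(S)\ge \frac{\rho(S^* )}{2}-\frac{56}{\epsilon}\ln(1/\delta)\ln n$.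
   Context: $\deg_S(j)$ is the number of neighbors of $j$ in $S$; $\rho(S)=|E(S)|/|S|$ is the density of the subgraph induced by $S$ (the densest subgraph problem asks for $S$ maximizing $\rho$). *)

(* Defs.v *)
From HB Require Import structures.
From mathcomp Require Import all_boot all_order all_algebra.
From mathcomp Require Import reals ereal sequences exp.

Set Implicit Arguments.
Unset Strict Implicit.
Unset Printing Implicit Defensive.

Import Order.TTheory GRing.Theory Num.Theory.
Local Open Scope ring_scope.

Section Graph.
Variables (V : finType) (adj : rel V).
Implicit Types S : {set V}.

Definition edges S : {set {set V}} :=
  [set [set x; y] | x in S, y in S & adj x y].

Definition deg S (j : V) : nat := #|[set i in S | adj j i]|.

(* At [S = set0] the value is the junk [0 / 0 = 0]; see [densest]. *)
Definition density (R : realType) S : R := #|edges S|%:R / #|S|%:R.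

(* Maximality is over nonempty sets, where the density is meaningful. *)
Definition densest (R : realType) S : Prop :=
  S != set0 /\ forall A : {set V}, A != set0 -> density R A <= density R S.

End Graph.

Definition eps_prime (R : realType) (eps delta : R) : R :=
  (1 - expR (- 1)) * eps / (8 * ln (expR 1 / delta)).

Section ParDenseDP.
Variables (R : realType) (V : finType) (adj : rel V) (eps eps' c : R).
Implicit Types A B S X : {set V}.

Definition node_pr A (j : V) : R := expR (- eps' * ((deg adj A j)%:R + c)).

(* Product law: the nodes of [A] are selected independently of each other, and
   [X] is exactly the set of selected nodes. *)
Definition select_pr A X : R :=
  \prod_(j in A) (if j \in X then node_pr A j else 1 - node_pr A j).

Definition step_pr A B : R :=
  \sum_(X : {set V} | (X \subset A) && (A :\: X == B)) select_pr A X.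

(* The probability that the loop, entered with the nonempty set [A], goes
   through exactly the successive nonempty sets listed in [w] and then reaches
   the empty set, where it stops. *)
Fixpoint loop_pr A (w : seq {set V}) : R :=
  if w is B :: w' then
    if B == set0 then 0 else step_pr A B * loop_pr B w'
  else step_pr A set0.

(* The exponential mechanism: [S \in w] ranges over the distinct members of
   [w], each counted once whatever its multiplicity in [w]. *)
Definition expmech_pr (w : seq {set V}) (E : pred {set V}) : R :=
  (\sum_(S : {set V} | (S \in w) && E S) expR (eps * density adj R S / 2)) /
  (\sum_(S : {set V} | S \in w) expR (eps * density adj R S / 2)).

(* The probability that the output satisfies [E], for nonempty [V]: the sum,
   over all terminating runs [S_1 = V, w_1, ..., w_k, set0], of the probability
   of the run times the conditional probability of [E] given the run. *)
Definition ParDenseDP_pr (E : pred {set V}) : \bar R :=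
  (\sum_(0 <= k <oo)
    (\sum_(w : k.-tuple {set V})
       loop_pr [set: V] w * expmech_pr ([set: V] :: w) E)%:E)%E.

End ParDenseDP.

(* Main.v *)
Require Import Defs.
From mathcomp Require Import all_boot all_order all_algebra.
From mathcomp Require Import reals ereal topology normedtype sequences exp.
From mathcomp Require Import ring lra.

Set Implicit Arguments.
Unset Strict Implicit.
Unset Printing Implicit Defensive.

Import Order.TTheory GRing.Theory Num.Theory.
Import numFieldNormedType.Exports.
Local Open Scope ring_scope.

(** Let [s] be the density slack. While the current set [A] contains the densest
    set [Sopt] and has density below [rho / 2 - s], some node of [A] has degree at
    most [rho - 2 s], whereas by optimality every node of [Sopt] has degree at
    least [rho] in [A]. With [2 eps' s >= 3 ln n], the nodes of [Sopt] together
    are expected to lose at most [n^-2] nodes for each node that [A] is expected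
    to lose; since at most [n] nodes are lost in all, a node of [Sopt] is
    hit while the density is low with probability at most [1/n]. As the loop ends
    almost surely, with the complementary probability it visits a set of density
    at least [rho / 2 - s]. A run visits at most [n] distinct sets, so the
    exponential mechanism then fails with probability at most [1/n]. *)

(** * Edge counts, degrees and density *)

Section GraphFacts.
Variables (V : finType) (adj : rel V).
Implicit Types S : {set V}.

(** Double counting of incidences: without loops, distinct neighbours of [j] give distinct edges at
    [j], and an edge has at most two endpoints. *)
Lemma sum_deg_le_edges S :
  irreflexive adj -> (\sum_(j in S) deg adj S j <= 2 * #|edges adj S|)%N.
Proof.
move=> adj_irr.
apply: (@leq_trans (\sum_(j in S) #|[set e in edges adj S | j \in e]|)).
  apply: leq_sum => j jS.
  rewrite /deg -(@card_in_imset _ _ (fun i => [set j; i])).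
    apply/subset_leq_card/subsetP => _ /imsetP[i + ->]; rewrite inE => /andP[iS ji].
    by rewrite !inE eqxx andbT; apply/imset2P; exists j i; rewrite ?inE ?iS.
  move=> i1 i2; rewrite !inE => /andP[_ a1] /andP[_ a2] /setP /(_ i1).
  rewrite !inE eqxx orbT; case: eqP => [e|_ /esym /eqP //].
  by rewrite -e adj_irr in a1.
under eq_bigr do rewrite -sum1dep_card big_mkcondr.
rewrite exchange_big /= mulnC -sum_nat_const; apply: leq_sum => e.
case/imset2P=> x y _ _ ->; rewrite -big_mkcondr /= sum1dep_card.
apply: (@leq_trans #|[set x; y]|); last by rewrite cards2; case: (x != y).
by apply/subset_leq_card/subsetP => z; rewrite !inE => /andP[].
Qed.

Lemma edges_setD1 S j :
  symmetric adj -> (#|edges adj S| <= #|edges adj (S :\ j)| + deg adj S j)%N.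
Proof.
move=> adj_sym.
apply: (@leq_trans #|edges adj (S :\ j) :|:
  [set [set j; i] | i in [set i in S | adj j i]]|).
  apply/subset_leq_card/subsetP => _ /imset2P[x y xS + ->].
  rewrite inE => /andP[yS xy]; rewrite inE.
  have [<-|xj] := eqVneq x j.
    by apply/orP; right; apply/imsetP; exists y; rewrite ?inE ?yS.
  have [yj|yj] := eqVneq y j.
    apply/orP; right; apply/imsetP; exists x; first by rewrite inE xS adj_sym -yj.
    by rewrite yj setUC.
  by apply/orP; left; apply/imset2P; exists x y; rewrite ?inE ?xj ?yj ?xS ?yS.
by apply: leq_trans (leq_card_setU _ _) _; rewrite leq_add2l leq_imset_card.
Qed.

Lemma edges0 : edges adj set0 = set0.
Proof.
by apply/eqP; rewrite -subset0; apply/subsetP => e /imset2P[x y]; rewrite in_set0.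
Qed.

Lemma deg_subset (A B : {set V}) j : A \subset B -> (deg adj A j <= deg adj B j)%N.
Proof.
move=> AB; apply/subset_leq_card/subsetP => i; rewrite !inE => /andP[iA ->].
by rewrite (subsetP AB).
Qed.

Lemma deg_le_card S j : (deg adj S j <= #|V|)%N.
Proof. exact: max_card. Qed.

Variable R : realType.

Lemma edges_eq_density S : S != set0 ->
  #|edges adj S|%:R = density adj R S * #|S|%:R.
Proof. by move=> S0; rewrite divfK // pnatr_eq0 cards_eq0. Qed.

(** The average degree is at most twice the density, so not every degree can exceed that. *)
Lemma exists_deg_le_density S : irreflexive adj -> S != set0 ->
  exists2 j, j \in S & (deg adj S j)%:R <= 2 * density adj R S.
Proof.
move=> irr S0.
case: (boolP [exists j, (j \in S) && ((deg adj S j)%:R <= 2 * density adj R S)]).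
  by case/existsP => j /andP[jS jd]; exists j.
move=> /existsPn H.
have : (2 * #|edges adj S|)%:R < \sum_(j in S) (deg adj S j)%:R :> R.
  rewrite natrM edges_eq_density // mulrA -[#|S|]sum1_card natr_sum mulr_sumr.
  have /set0Pn[k kS] := S0.
  apply: ltr_sum => [|i iS]; first by apply/hasP; exists k; rewrite ?mem_index_enum.
  by have := H i; rewrite iS /= -ltNge mulr1.
by rewrite -natr_sum ltr_nat ltnNge sum_deg_le_edges.
Qed.

(** Otherwise deleting [j] would lose too few edges for one node and leave a denser set. *)
Lemma densest_density_le_deg S j :
  symmetric adj -> densest adj R S -> j \in S ->
  density adj R S <= (deg adj S j)%:R.
Proof.
move=> sym [S0 opt] jS.
have : #|edges adj (S :\ j)|%:R <= density adj R S * #|S :\ j|%:R.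
  (* Optimality says nothing about the empty set, but there both sides vanish. *)
  have [->|Sj0] := eqVneq (S :\ j) set0; first by rewrite edges0 !cards0 mulr0.
  by rewrite edges_eq_density // ler_wpM2r // opt.
have := edges_setD1 S j sym; rewrite -(ler_nat R) natrD edges_eq_density //.
by rewrite (cardsD1 j S) jS natrD mulrDr mulr1; lra.
Qed.

End GraphFacts.

(** * Sums over subsets and tuples *)

Lemma sum_subset_prod (R : comNzRingType) (V : finType) (A : {set V}) (F G : V -> R) :
  \sum_(X : {set V} | X \subset A) \prod_(j in A) (if j \in X then F j else G j) =
  \prod_(j in A) (F j + G j).
Proof.
(* Outside [A], the value [0] kills every [X] not contained in [A] and the value [1] leaves the
   other products unchanged. *)
pose F' j := if j \in A then F j else 0; pose G' j := if j \in A then G j else 1.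
transitivity (\prod_j (F' j + G' j)); last first.
  by rewrite [RHS]big_mkcond; apply: eq_bigr => j _; rewrite /F' /G';
  case: ifP; rewrite ?add0r.
rewrite bigA_distr [RHS](bigID (fun X : {set V} => X \subset A)) /=.
rewrite [X in _ + X]big1 ?addr0 => [|X /subsetPn[j jX jA]]; last first.
  by rewrite (bigD1 j) //= jX /F' (negbTE jA) mul0r.
apply: eq_bigr => X /subsetP XA; rewrite big_mkcond; apply: eq_bigr => j _.
rewrite /F' /G'; case: (boolP (j \in A)) => // jA.
by case: ifP => // /XA; rewrite (negbTE jA).
Qed.

Lemma big_tuple_cons (R : nmodType) (T : finType) k (F : k.+1.-tuple T -> R) :
  \sum_(w : k.+1.-tuple T) F w = \sum_(x : T) \sum_(w : k.-tuple T) F [tuple of x :: w].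
Proof.
rewrite pair_big /= (reindex (fun p : T * k.-tuple T => [tuple of p.1 :: p.2])) //=.
exists (fun w : k.+1.-tuple T => (thead w, [tuple of behead w])) => [[x w] _|w _] /=.
  by congr pair; apply: val_inj.
by rewrite -tuple_eta.
Qed.

(** * The law of the deletion process and of its runs *)

Section Process.
Variables (R : realType) (V : finType) (adj : rel V) (eps' c : R).
Hypotheses (eps'_ge0 : 0 <= eps') (c_ge0 : 0 <= c).
Implicit Types (A B S X : {set V}) (w : seq {set V}) (P : pred {set V}) (N k : nat).

Local Notation node_pr := (node_pr adj eps' c).
Local Notation select_pr := (select_pr adj eps' c).
Local Notation step_pr := (step_pr adj eps' c).
Local Notation loop_pr := (loop_pr adj eps' c).

Lemma node_pr_gt0 A j : 0 < node_pr A j.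
Proof. exact: expR_gt0. Qed.

Lemma node_pr_le1 A j : node_pr A j <= 1.
Proof. by rewrite -expR0 ler_expR mulNr oppr_le0 mulr_ge0 // addr_ge0. Qed.

Lemma select_pr_ge0 A X : 0 <= select_pr A X.
Proof.
apply: prodr_ge0 => j _; case: ifP => _; first exact/ltW/node_pr_gt0.
by rewrite subr_ge0 node_pr_le1.
Qed.

Lemma sum_select_pr A : \sum_(X : {set V} | X \subset A) select_pr A X = 1.
Proof.
by rewrite sum_subset_prod big1 // => j _; rewrite addrC subrK.
Qed.

(** Zeroing the non-selection factor of [j] keeps only the [X] containing [j], so the product
    expansion still applies. *)
Lemma select_pr_marginal A j : j \in A ->
  \sum_(X : {set V} | X \subset A) select_pr A X * (j \in X)%:R = node_pr A j.
Proof.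
move=> jA; pose G i := if i == j then 0 else 1 - node_pr A i.
transitivity (\prod_(i in A) (node_pr A i + G i)).
  rewrite -sum_subset_prod; apply: eq_bigr => X _.
  rewrite /Defs.select_pr (bigD1 j) // [RHS](bigD1 j) //= /G eqxx.
  case: ifP => _; rewrite ?mulr1 ?mulr0 ?mul0r //; congr (_ * _).
  by apply: eq_bigr => i /andP[_ /negPf->].
rewrite (bigD1 j) //= /G eqxx addr0 big1 ?mulr1 // => i /andP[_ /negPf->].
by rewrite addrC subrK.
Qed.

Lemma step_pr_ge0 A B : 0 <= step_pr A B.
Proof. by apply: sumr_ge0 => X _; apply: select_pr_ge0. Qed.

Lemma sum_step_pr A (f : {set V} -> R) :
  \sum_B step_pr A B * f B = \sum_(X : {set V} | X \subset A) select_pr A X * f (A :\: X).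
Proof.
rewrite [RHS](partition_big (fun X => A :\: X) predT) //=.
apply: eq_bigr => B _; rewrite mulr_suml; apply: eq_bigr => X /andP[_ /eqP->] //.
Qed.

Lemma step_pr_mass1 A : \sum_B step_pr A B = 1.
Proof.
rewrite -[RHS](sum_select_pr A); have := sum_step_pr A (fun=> 1).
by under eq_bigr do rewrite mulr1; under [in RHS]eq_bigr do rewrite mulr1.
Qed.

Lemma step_pr_subset A B : step_pr A B != 0 -> B \subset A.
Proof.
apply: contraNT => BA; rewrite /Defs.step_pr big1 // => X /andP[_ /eqP AX].
by rewrite -AX subsetDl in BA.
Qed.

Lemma loop_pr_ge0 A w : 0 <= loop_pr A w.
Proof.
elim: w A => [|B w IH] A /=; first exact: step_pr_ge0.
by case: ifP => // _; rewrite mulr_ge0 ?step_pr_ge0.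
Qed.

(** The sets of a possible run decrease, so each new distinct set costs at least one node. *)
Lemma card_run A w : A != set0 -> loop_pr A w != 0 ->
  (#|[set S in A :: w]| <= #|A|)%N.
Proof.
elim: w A => [|B w IH] A A0 /=.
  have -> : [set S in [:: A]] = [set A] by apply/setP => S; rewrite !inE.
  by rewrite cards1 card_gt0.
case: (eqVneq B set0) => B0; first by rewrite eqxx.
rewrite mulf_eq0 negb_or => /andP[/step_pr_subset BA /IH -/(_ B0) le_w].
rewrite set_cons; have [eqAB|neAB] := eqVneq A B.
  by rewrite (setUidPr _) ?eqAB // sub1set !inE eqxx.
rewrite cardsU1; apply: leq_trans (_ : 1 + #|B| <= _)%N.
  by apply: leq_add => //; case: (_ \notin _).
by apply: proper_card; rewrite properEneq eq_sym neAB.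
Qed.

(* The probability that the loop entered with [A] stops within [N] iterations
   after visiting only sets in [P]. *)
Definition run_mass P N A : R :=
  \sum_(k < N) \sum_(w : k.-tuple {set V}) loop_pr A w * (all P (A :: w))%:R.

Lemma run_mass_recl P N A : run_mass P N.+1 A =
  (P A)%:R * (step_pr A set0 + \sum_(B | B != set0) step_pr A B * run_mass P N B).
Proof.
rewrite /run_mass big_ord_recl (big_pred1 [tuple]); last by move=> w; apply/esym/eqP/tuple0.
rewrite /= andbT mulrDr mulrC; congr (_ + _).
under eq_bigr => k _.
  rewrite big_tuple_cons.
  over.
rewrite exchange_big /= mulr_sumr [RHS]big_mkcond; apply: eq_bigr => B _.
case: (eqVneq B set0) => [->|B0] /=.
  by rewrite big1 // => k _; rewrite big1 // => w _; rewrite mul0r.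
rewrite !mulr_sumr; apply: eq_bigr => k _; rewrite !mulr_sumr.
apply: eq_bigr => w _; rewrite -mulnb natrM; ring.
Qed.

(** Induction step for upper bounds: [1 <= f set0] absorbs the probability of stopping at once. *)
Lemma run_mass_le_step P N A (f : {set V} -> R) :
  1 <= f set0 -> (forall B, B != set0 -> run_mass P N B <= f B) ->
  run_mass P N.+1 A <= (P A)%:R * \sum_B step_pr A B * f B.
Proof.
move=> f0 fP; rewrite run_mass_recl ler_wpM2l // [leRHS](bigD1 set0) //=.
apply: lerD; first by rewrite ler_peMr ?step_pr_ge0.
by apply: ler_sum => B B0; rewrite ler_wpM2l ?step_pr_ge0 ?fP.
Qed.

Lemma run_mass_le1 P N A : run_mass P N A <= 1.
Proof.
elim: N A => [|N IH] A; first by rewrite /run_mass big_ord0.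
apply: le_trans (run_mass_le_step (f := fun=> 1) _ _ _) _ => //.
under eq_bigr do rewrite mulr1.
by rewrite step_pr_mass1 mulr1; case: (P A).
Qed.

(** The loop stops when all of [A] is selected; bounding degrees and [#|A|] by [#|V|] makes the
    bound uniform in [A]. *)
Lemma step_pr_set0_ge A : expR (- eps' * (#|V|%:R + c)) ^+ #|V| <= step_pr A set0.
Proof.
have le1 : expR (- eps' * (#|V|%:R + c)) <= 1.
  by rewrite -expR0 ler_expR mulNr oppr_le0 mulr_ge0 // addr_ge0.
rewrite /Defs.step_pr (bigD1 A) /=; last by rewrite subxx setDv eqxx.
rewrite -[leLHS]addr0; apply: lerD; last first.
  by apply: sumr_ge0 => X _; apply: select_pr_ge0.
apply: (@le_trans _ _ (expR (- eps' * (#|V|%:R + c)) ^+ #|A|)).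
  by rewrite ler_wiXn2l ?expR_ge0 // max_card.
rewrite -prodr_const; apply: ler_prod => j jA; rewrite jA expR_ge0 /=.
rewrite ler_expR ler_wnM2l ?oppr_le0 // lerD2r ler_nat; exact: deg_le_card.
Qed.

(** Every iteration stops with at least a fixed probability, so survival decays geometrically. *)
Lemma run_mass_total_ge N A :
  1 - (1 - expR (- eps' * (#|V|%:R + c)) ^+ #|V|) ^+ N <= run_mass predT N A.
Proof.
set q := _ ^+ #|V|; have q_le s := step_pr_set0_ge s; rewrite -/q in q_le.
have q1 : q <= 1.
  apply: le_trans (q_le set0) _; rewrite -(step_pr_mass1 set0) (bigD1 set0) //=.
  by rewrite lerDl sumr_ge0 // => B _; apply: step_pr_ge0.
elim: N A => [|N IH] A; first by rewrite /run_mass big_ord0 expr0 subrr.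
rewrite run_mass_recl mul1r; set r := (1 - q) ^+ N in IH *.
have r0 : 0 <= r by rewrite exprn_ge0 ?subr_ge0.
apply: (@le_trans _ _ (step_pr A set0 + (1 - step_pr A set0) * (1 - r))).
  have := ler_wpM2r r0 (q_le A); rewrite exprS -/r; lra.
rewrite lerD2l -[X in X - _](step_pr_mass1 A) (bigD1 set0) //= addrAC subrr add0r.
by rewrite mulr_suml; apply: ler_sum => B _; rewrite ler_wpM2l ?step_pr_ge0.
Qed.

(* [#|A| * eta] is a supersolution of [run_mass_recl] as long as [S \subset A]:
   by linearity of expectation one step decreases [#|A|] by
   [\sum_(i in A) node_pr A i] on average, and it hits [S] with probability at most
   [\sum_(j in S) node_pr A j]; the mass after a hit is bounded by [1]. *)
Lemma run_mass_le_card P (S : {set V}) (eta : R) : 0 <= eta -> S != set0 ->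
  (forall A, S \subset A -> P A ->
     \sum_(j in S) node_pr A j <= eta * \sum_(i in A) node_pr A i) ->
  forall N A, S \subset A -> run_mass P N A <= #|A|%:R * eta.
Proof.
move=> eta0 S0 HP; elim=> [|N IH] A SA.
  by rewrite /run_mass big_ord0 mulr_ge0.
pose f B := if S \subset B then #|B|%:R * eta else 1.
apply: le_trans (run_mass_le_step (f := f) _ _ _) _.
- by rewrite /f subset0 (negbTE S0).
- by move=> B _; rewrite /f; case: ifP => [/IH//|_]; apply: run_mass_le1.
case: (boolP (P A)) => PA; last by rewrite mul0r mulr_ge0.
rewrite mul1r sum_step_pr.
(* Pointwise in [X]: if [S] is not hit, the surviving nodes pay for [f]; if it is, the indicator of
   one hit node is already [1]. This bound is affine in the indicators, so only marginals matter. *)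
apply: (@le_trans _ _ (\sum_(X : {set V} | X \subset A) select_pr A X *
    (\sum_(j in S) (j \in X)%:R + eta * \sum_(i in A) (1 - (i \in X)%:R)))).
  apply: ler_sum => X XA; rewrite ler_wpM2l ?select_pr_ge0 //.
  have cardD : \sum_(i in A) (1 - (i \in X)%:R) = #|A :\: X|%:R :> R.
    rewrite -sum1_card natr_sum big_mkcond [RHS]big_mkcond /=.
    apply: eq_bigr => i _; rewrite inE andbC.
    by case: (i \in A); case: (i \in X); rewrite /= ?subrr ?subr0.
  have hit_ge0 : 0 <= \sum_(j in S) (j \in X)%:R :> R by apply: sumr_ge0.
  rewrite cardD /f; case: ifP => [_|/negbT/subsetPn[j jS]].
    by rewrite mulrC lerDr.
  rewrite inE (subsetP SA) // andbT negbK => jX.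
  rewrite -[leLHS]addr0 lerD // ?mulr_ge0 // (bigD1 j) //= jX lerDl.
  exact: sumr_ge0.
under eq_bigr do rewrite mulrDr mulr_sumr mulrCA mulr_sumr.
rewrite big_split /= exchange_big /= -mulr_sumr [X in _ + _ * X]exchange_big /=.
under eq_bigr => j jS do rewrite select_pr_marginal ?(subsetP SA) //.
under [X in _ + _ * X]eq_bigr => i iA.
  under eq_bigr do rewrite mulrBr mulr1.
  rewrite sumrB sum_select_pr select_pr_marginal //.
  over.
rewrite sumrB sumr_const.
by have := HP A SA PA; lra.
Qed.

End Process.

(** * The exponential mechanism and the output probability *)

Section Output.
Variables (R : realType) (V : finType) (adj : rel V) (eps eps' c : R).
Hypotheses (eps'_ge0 : 0 <= eps') (c_ge0 : 0 <= c).

Lemma expmech_pr_ge0 (r : seq {set V}) (E : pred {set V}) :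
  0 <= expmech_pr adj eps r E.
Proof. by rewrite divr_ge0 // sumr_ge0 // => S _; apply: expR_ge0. Qed.

(** Each of the at most [n] failing sets weighs at most [eta] times the weight of [M], itself a term
    of the normalizer. *)
Lemma expmech_pr_ge (r : seq {set V}) (E : pred {set V}) M n (eta : R) :
  M \in r -> (#|[set S in r]| <= n)%N -> 0 <= eta ->
  (forall S, ~~ E S ->
     expR (eps * density adj R S / 2) <= eta * expR (eps * density adj R M / 2)) ->
  1 - n%:R * eta <= expmech_pr adj eps r E.
Proof.
move=> Mr r_le eta0 fail; rewrite /expmech_pr.
set z := fun S => expR (eps * density adj R S / 2).
set Z := \sum_(S : {set V} | S \in r) z S.
have zM_le : z M <= Z.
  by rewrite /Z (bigD1 M) //= lerDl sumr_ge0 // => S _; apply: expR_ge0.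
have Z_gt0 : 0 < Z by apply: lt_le_trans zM_le; apply: expR_gt0.
rewrite ler_pdivlMr // mulrBl mul1r lerBlDr {1}/Z (bigID E) /= lerD2l.
apply: (@le_trans _ _ (\sum_(S in [set S in r]) eta * z M)).
  rewrite [leRHS](bigID E) /= -[leLHS]add0r; apply: lerD.
    by apply: sumr_ge0 => S _; rewrite mulr_ge0 ?expR_ge0.
  under [leRHS]eq_bigl do rewrite inE.
  by apply: ler_sum => S /andP[_ /fail].
rewrite sumr_const -[_ *+ _]mulr_natl -mulrA; apply: ler_pM => //.
- by rewrite mulr_ge0 ?expR_ge0.
- by rewrite ler_nat.
- exact: ler_wpM2l.
Qed.

(** Truncating a nonnegative series keeps a lower bound, and the difference of masses counts the
    runs that visit a set outside [P]. *)
Lemma ParDenseDP_pr_ge (P E : pred {set V}) (theta : R) N : theta <= 1 ->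
  (forall w, loop_pr adj eps' c [set: V] w != 0 -> ~~ all P ([set: V] :: w) ->
     1 - theta <= expmech_pr adj eps ([set: V] :: w) E) ->
  (((1 - theta) * (run_mass adj eps' c predT N [set: V] -
                   run_mass adj eps' c P N [set: V]))%:E
    <= ParDenseDP_pr adj eps eps' c E)%E.
Proof.
move=> theta1 HE; have loop0 := loop_pr_ge0 adj eps'_ge0 c_ge0.
apply: le_trans (nneseries_lim_ge N _); last first.
  move=> k _ _; rewrite lee_fin; apply: sumr_ge0 => w _.
  by rewrite mulr_ge0 ?expmech_pr_ge0.
rewrite sumEFin lee_fin big_mkord /run_mass -sumrB mulr_sumr.
apply: ler_sum => k _; rewrite -sumrB mulr_sumr; apply: ler_sum => w _.
rewrite -mulrBr mulrCA.
have [->|w0] := eqVneq (loop_pr adj eps' c [set: V] w) 0; first by rewrite !mul0r.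
rewrite ler_wpM2l // all_predT; have := HE _ w0; case: (all P _) => /= [_|/(_ isT) le_E].
  by rewrite subrr mulr0 expmech_pr_ge0.
by rewrite subr0 mulr1.
Qed.

End Output.

(** Removes the truncation error by letting [N] tend to infinity. *)
Lemma lee_geometric (R : realType) (x r : R) (y : \bar R) : 0 <= r < 1 ->
  (forall N, (x - r ^+ N)%:E <= y)%E -> (x%:E <= y)%E.
Proof.
move=> /andP[r0 r1] H; apply/lee_addgt0Pr => e e0.
have r1' : `|r| < 1 by rewrite ger0_norm.
have [N _ /(_ N (leqnn N)) /=] := (cvgrPdist_lt _ _).1 (cvg_expr r1') e e0.
rewrite sub0r normrN ger0_norm ?exprn_ge0 // => rN.
rewrite -leeBlDr // -EFinB; apply: le_trans (H N); rewrite lee_fin lerD2l lerN2; exact: ltW.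
Qed.

(** * Bounds on the constants *)

Section Constants.
Variables (R : realType) (eps delta : R).
Hypotheses (eps_gt0 : 0 < eps) (delta_rg : 0 < delta <= expR (- 1)).

Lemma ln_inv_delta_ge1 : 1 <= ln (1 / delta).
Proof.
have /andP[d0 d1] := delta_rg.
by rewrite div1r lnV ?posrE // lerNr -[leRHS](@expRK R) ler_ln ?posrE ?expR_gt0.
Qed.

(** Uses [expR (- 1) <= 1 / 2] and [ln (expR 1 / delta) = 1 + ln (1 / delta) <= 2 * ln (1 /
    delta)]. *)
Lemma eps_prime_ge :
  eps / (32 * ln (1 / delta)) <= eps_prime eps delta.
Proof.
have L1 := ln_inv_delta_ge1; have /andP[d0 _] := delta_rg.
have e2 : expR (- 1) <= 2^-1 :> R.
  by rewrite expRN lef_pV2 ?posrE ?expR_gt0 //; apply: le_trans (expR_ge1Dx 1); lra.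
have LE : ln (expR 1 / delta) = 1 + ln (1 / delta).
  by rewrite div1r lnM ?posrE ?expR_gt0 ?invr_gt0 // expRK.
rewrite /eps_prime LE ler_pdivlMr; last by lra.
rewrite mulrAC ler_pdivrMr; last by lra.
have : 0 <= (2^-1 - expR (- 1)) * (eps * ln (1 / delta)).
  by rewrite !mulr_ge0 ?subr_ge0 ?(ltW eps_gt0) //; lra.
have : eps <= eps * ln (1 / delta) by rewrite ler_peMr // ltW.
lra.
Qed.

End Constants.

(** * The density guarantee *)

Theorem theoremA5 (R : realType) (V : finType) (adj : rel V)
    (eps delta c : R) (Sopt : {set V}) :
  symmetric adj -> irreflexive adj -> (0 < #|V|)%N ->
  0 < eps <= 1 -> 0 < delta <= expR (- 1) ->
  (eps_prime eps delta)^-1 + 1 <= c ->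
  densest adj R Sopt ->
  ((1 - 2 / #|V|%:R)%:E <=
   ParDenseDP_pr adj eps (eps_prime eps delta) c
     (fun S => (density adj R Sopt / 2 - 56 / eps * ln (1 / delta) * ln #|V|%:R
               <= density adj R S)%R))%E.
Proof.
move=> sym irr V0 /andP[eps0 _] delta_rg c_ge opt.
set n : R := #|V|%:R; set L := ln (1 / delta); set lam := ln n.
set e' := eps_prime eps delta in c_ge *.
set rho := density adj R Sopt; set E := fun S => _ <= _.
have n1 : 1 <= n by rewrite ler1n.
have n0 : 0 < n by lra.
have lam0 : 0 <= lam by apply: ln_ge0.
have L1 : 1 <= L by apply: ln_inv_delta_ge1.
have e'_ge : eps / (32 * L) <= e' by apply: eps_prime_ge.
have e'0 : 0 < e' by apply: lt_le_trans e'_ge; rewrite divr_gt0 // mulr_gt0 //; lra.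
have c0 : 0 <= c by apply: le_trans c_ge; rewrite addr_ge0 // invr_ge0 ltW.
have exp_lam k : expR (k%:R * lam) = n ^+ k by rewrite expRM_natl lnK.
(* Of the constant 56, the loop uses 48, which gives [e' * s >= 3 / 2 * lam]; the remaining 8 is
   left for the exponential mechanism. *)
pose s := 48 / eps * L * lam.
have s_ge : 3 * lam <= 2 * (e' * s).
  have : eps / (32 * L) * s <= e' * s.
    by rewrite ler_wpM2r // !mulr_ge0 ?invr_ge0 //; lra.
  have -> : eps / (32 * L) * s = 3 / 2 * lam by rewrite /s; field; apply/andP; split; lra.
  lra.
pose bad : pred {set V} := fun A => density adj R A < rho / 2 - s.
have bad_mass N : run_mass adj e' c bad N [set: V] <= n^-1.
  have -> : n^-1 = #|[set: V]|%:R * (n ^+ 2)^-1.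
    by rewrite cardsT -/n; field; lra.
  apply: (run_mass_le_card (ltW e'0) c0 (S := Sopt)); rewrite ?subsetT //.
  - by rewrite invr_ge0 exprn_ge0 // ltW.
  - by case: opt.
  move=> A SA badA; have A0 : A != set0.
    by case: opt => /set0Pn[j jS] _; apply/set0Pn; exists j; apply: (subsetP SA).
  have [i iA i_deg] := exists_deg_le_density R irr A0.
  (* Bounds the selection probability of every node of [Sopt], whose degree in [A] is at least
     [rho]. *)
  pose q := expR (- e' * (rho + c)).
  apply: (@le_trans _ _ (n * q)).
    apply: (@le_trans _ _ (\sum_(j in Sopt) q)).
      apply: ler_sum => j jS; rewrite ler_expR ler_wnM2l ?oppr_le0 ?(ltW e'0) // lerD2r.
      apply: le_trans (densest_density_le_deg sym opt jS) _.
      by rewrite ler_nat deg_subset.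
    by rewrite sumr_const -mulr_natl ler_wpM2r ?expR_ge0 // ler_nat max_card.
  (* The low-degree node [i] alone suffices: its selection probability is at least [n ^+ 3 * q]. *)
  rewrite ler_pdivlMl ?exprn_gt0 // (bigD1 i) //=.
  apply: (@le_trans _ _ (node_pr adj e' c A i)); last first.
    by rewrite lerDl sumr_ge0 // => j _; apply: expR_ge0.
  rewrite mulrA -exprSr -exp_lam -expRD ler_expR.
  have : e' * (deg adj A i)%:R <= e' * (rho - 2 * s).
    rewrite ler_wpM2l ?(ltW e'0) //; move: badA i_deg; rewrite /bad /=; lra.
  lra.
have out w : loop_pr adj e' c [set: V] w != 0 -> ~~ all bad ([set: V] :: w) ->
    1 - n^-1 <= expmech_pr adj eps ([set: V] :: w) E.
  move=> w0 /allPn[M Mw]; rewrite /bad -leNgt => M_ge.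
  have -> : n^-1 = #|V|%:R * (n ^+ 2)^-1 by rewrite -/n; field; lra.
  apply: expmech_pr_ge Mw _ _ _.
  - rewrite -cardsT; apply: card_run w0.
    by rewrite -card_gt0 cardsT.
  - by rewrite invr_ge0 exprn_ge0 // ltW.
  move=> S; rewrite /E -ltNge => S_lt.
  rewrite ler_pdivlMl ?exprn_gt0 // -exp_lam -expRD ler_expR.
  (* After halving, this gap lowers the exponent by [4 * L * lam], more than the [2 * lam] required
     for the factor [n ^+ 2]. *)
  have : eps * density adj R S <= eps * (density adj R M - 8 / eps * L * lam).
    rewrite ler_wpM2l ?(ltW eps0) //; move: S_lt M_ge; rewrite /s; lra.
  have -> : eps * (density adj R M - 8 / eps * L * lam) =
            eps * density adj R M - 8 * (L * lam) by field; lra.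
  have : lam <= L * lam by rewrite ler_peMl.
  lra.
set p := expR (- e' * (n + c)) ^+ #|V|.
have p0 : 0 < p by rewrite exprn_gt0 ?expR_gt0.
have p1 : p <= 1.
  by rewrite exprn_ile1 ?expR_ge0 // -expR0 ler_expR mulNr oppr_le0 mulr_ge0
    ?addr_ge0 ?(ltW e'0) ?(ltW n0).
apply: (@lee_geometric _ _ (1 - p)) => [|N]; first by lra.
have ninv1 : n^-1 <= 1 by rewrite invf_le1.
apply: le_trans (ParDenseDP_pr_ge (ltW e'0) c0 N ninv1 out); rewrite lee_fin.
have total := run_mass_total_ge adj (ltW e'0) c0 N [set: V]; rewrite -/n -/p in total.
have ninv0 : 0 < n^-1 by rewrite invr_gt0.
have r0 : 0 <= (1 - p) ^+ N by rewrite exprn_ge0 // subr_ge0.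
(* The two failure probabilities [n^-1], from the loop and from the mechanism, combine into
   [2 / n]. *)
apply: (@le_trans _ _ ((1 - n^-1) * (1 - (1 - p) ^+ N - n^-1))); last first.
  by rewrite ler_wpM2l ?subr_ge0 // lerB.
nra.
Qed.
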